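(* Let $p$ be a prime, let $G$ be a locally finite $p$-group, let $R=\bigoplus_{g\in G}R_g$ be a $G$-graded associative ring with identity, and let $H$ be a normal subgroup of $G$. Assume that $p$ is nilpotent in $R$. If $R$ is graded nil-good as a $G/H$-graded ring, then $R[H]$ is graded nil-good as a $G/H$-graded ring.
   Context: A ring $R$ is $G$-graded if $R=\bigoplus_{g\in G}R_g$ with $R_g$ additive subgroups and $R_gR_h\subseteq R_{gh}$ for all $g,h\in G$; elements of the components are called homogeneous. If $H$ is a normal subgroup of $G$, a $G$-graded ring $R$ is viewed as a $G/H$-graded ring via $R=\bigoplus_{C\in G/H}R_C$ with $R_C=\bigoplus_{x\in C}R_x$. For a $G$-graded ring $R$, the graded group ring $R[G]$ is the free left $R$-module on $G$ with multiplication determined by $(r_g g')(r_h h')=r_gr_h\,(h^{-1}g'hh')$ for $g,g',h,h'\in G$, $r_g\in R_g$, $r_h\in R_h$; it is $G$-graded with components $(R[G])_g=\sum_{h\in G}R_{gh^{-1}}h$. For a normal subgroup $H$ of $G$, $R[H]$ denotes the subring of elements $\sum_{h\in H}r_hh$, and it is $G/H$-graded with components $(R[H])_C=\sum_{h\in H}R_Ch$, $C\in G/H$. A graded ring is graded nil-good if each of its homogeneous elements is either nilpotent or a sum of a homogeneous unit and a homogeneous nilpotent. *)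

(* Defs.v *)
From HB Require Import structures.
From mathcomp Require Import all_boot all_algebra finmap.
From mathcomp Require Import boolp classical_sets cardinality.
From mathcomp Require Import monalg.

Set Implicit Arguments.
Unset Strict Implicit.
Unset Printing Implicit Defensive.

Import GRing.Theory.
Local Open Scope ring_scope.
Local Open Scope quotient_scope.

(* [groupType] is the type of arbitrary, possibly infinite, groups, and
   [pzRingType] that of associative rings with identity, where 1 = 0 is not
   excluded. [{malg V[K]}] is the additive group of finitely supported
   functions K -> V: [d@_k] is the value at k, [msupp d] the support and
   [<< v *g k >>] the function with value v at k and 0 elsewhere. *)

Definition is_subgroup (G : groupType) (K : set G) : Prop :=
  K 1%g /\ forall x y, K x -> K y -> K (x * y^-1)%g.

Definition locally_finite (G : groupType) : Prop :=
  forall s : seq G,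
    finite_set (smallest (@is_subgroup G) [set x | x \in s]%classic).

Definition p_group (p : nat) (G : groupType) : Prop :=
  forall x : G, exists n, (x ^+ (p ^ n) = 1)%g.

Record normal_subgroup (G : groupType) := NormalSubgroup {
  nsub_set :> G -> Prop;
  nsub_subgroup : is_subgroup nsub_set;
  nsub_normal : forall x y, nsub_set x -> nsub_set (y^-1 * x * y)%g }.

Section NormalSubgroup.
Context (G : groupType) (H : normal_subgroup G).
Local Open Scope group_scope.

Lemma nsub1 : H 1. Proof. exact: (nsub_subgroup H).1. Qed.

Lemma nsubV x : H x -> H x^-1.
Proof. by move=> Hx; rewrite -[x^-1]mul1g; apply: (nsub_subgroup H).2 nsub1 Hx. Qed.

Lemma nsubM x y : H x -> H y -> H (x * y).
Proof.
by move=> Hx Hy; rewrite -[y]invgK; apply: (nsub_subgroup H).2 Hx (nsubV Hy).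
Qed.

Definition coset_rel : rel G := fun x y => `[< H (x^-1 * y) >].

Lemma coset_rel_refl : reflexive coset_rel.
Proof. by move=> x; apply/asboolP; rewrite mulVg; exact: nsub1. Qed.

Lemma coset_rel_sym : symmetric coset_rel.
Proof.
by move=> x y; apply/asboolP/asboolP => /nsubV; rewrite invgM invgK.
Qed.

Lemma coset_rel_trans : transitive coset_rel.
Proof.
move=> y x z /asboolP Hxy /asboolP Hyz; apply/asboolP.
by have := nsubM Hxy Hyz; rewrite !mulgA mulgK.
Qed.

Canonical coset_equiv := EquivRel coset_rel
  coset_rel_refl coset_rel_sym coset_rel_trans.

Definition quo := {eq_quot coset_equiv}.
HB.instance Definition _ := Choice.on quo.
HB.instance Definition _ := EqQuotient.on quo.

Lemma pi_quoE x y : \pi_quo x = \pi_quo y <-> H (x^-1 * y).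
Proof.
by split=> [/eqP|Hxy]; [rewrite eqmodE => /asboolP|apply/eqP; rewrite eqmodE; apply/asboolP].
Qed.

Definition quo_mul (C D : quo) : quo := \pi_quo (repr C * repr D).
Definition quo_inv (C : quo) : quo := \pi_quo (repr C)^-1.

Lemma quo_mulE x y : quo_mul (\pi_quo x) (\pi_quo y) = \pi_quo (x * y).
Proof.
have Hx : H ((repr (\pi_quo x))^-1 * x) by apply/pi_quoE; rewrite reprK.
have Hy : H ((repr (\pi_quo y))^-1 * y) by apply/pi_quoE; rewrite reprK.
apply/pi_quoE; set x' := repr _; set y' := repr _.
have -> : (x' * y')^-1 * (x * y) =
    (y'^-1 * (x'^-1 * x) * y') * (y'^-1 * y).
  by rewrite invgM !mulgA mulgK.
by apply: nsubM Hy; apply: nsub_normal.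
Qed.

Lemma quo_invE x : quo_inv (\pi_quo x) = \pi_quo x^-1.
Proof.
have Hx : H (x^-1 * repr (\pi_quo x)) by apply/pi_quoE; rewrite reprK.
apply/pi_quoE; set x' := repr _; rewrite invgK.
have := @nsub_normal _ H _ (x^-1) Hx.
by rewrite invgK !mulgA mulgV mul1g.
Qed.

Lemma quo_mulA : associative quo_mul.
Proof.
move=> x y z; elim/quotW: x => x; elim/quotW: y => y; elim/quotW: z => z.
by rewrite (quo_mulE y z) (quo_mulE x (y * z)) (quo_mulE x y) (quo_mulE (x * y) z) mulgA.
Qed.
Lemma quo_mul1 : left_id (\pi_quo 1) quo_mul.
Proof. by move=> x; elim/quotW: x => x; rewrite quo_mulE mul1g. Qed.
Lemma quo_mulr1 : right_id (\pi_quo 1) quo_mul.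
Proof. by move=> x; elim/quotW: x => x; rewrite quo_mulE mulg1. Qed.
Lemma quo_mulV : left_inverse (\pi_quo 1) quo_inv quo_mul.
Proof. by move=> x; elim/quotW: x => x; rewrite quo_invE quo_mulE mulVg. Qed.
Lemma quo_mulrV : right_inverse (\pi_quo 1) quo_inv quo_mul.
Proof. by move=> x; elim/quotW: x => x; rewrite quo_invE quo_mulE mulgV. Qed.

HB.instance Definition _ := isGroup.Build quo
  quo_mulA quo_mul1 quo_mulr1 quo_mulV quo_mulrV.

Lemma pi_quoM x y : \pi_quo (x * y) = (\pi_quo x * \pi_quo y :> quo).
Proof. by rewrite -quo_mulE. Qed.

End NormalSubgroup.

Section FinSuppSum.
Context (K : choiceType) (V W : zmodType) (f : K -> V -> W).
Hypothesis f0 : forall k, f k 0 = 0.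

Definition msum (a : {malg V[K]}) : W := \sum_(k <- msupp a) f k a@_k.

Lemma msumEw (a : {malg V[K]}) (D : {fset K}) : (msupp a `<=` D)%fset ->
  msum a = \sum_(k <- D) f k a@_k.
Proof.
by move=> aD; apply: big_fset_incl aD _ => k _ /mcoeff_outdom ->.
Qed.

Lemma msumU k v : msum << v *g k >> = f k v.
Proof. by rewrite (msumEw msuppU_le) big_seq_fset1 mcoeffUU. Qed.

Lemma msum0 : msum 0 = 0.
Proof. by rewrite /msum msupp0 big_seq_fset0. Qed.

Hypothesis fD : forall k, {morph f k : x y / x + y}.

Lemma msumD : {morph msum : a b / a + b}.
Proof.
move=> a b; rewrite (msumEw (msuppD_le a b)) (msumEw (fsubsetUl (msupp a) (msupp b))).
rewrite (msumEw (fsubsetUr (msupp a) (msupp b))) -big_split /=.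
by apply: eq_bigr => k _; rewrite mcoeffD fD.
Qed.

End FinSuppSum.

Lemma morphD_0 (V W : zmodType) (f : V -> W) : {morph f : x y / x + y} -> f 0 = 0.
Proof. by move=> fD; apply: (addrI (f 0)); rewrite -fD !addr0. Qed.

Lemma morphD_sum (V W : zmodType) (f : V -> W) : {morph f : x y / x + y} ->
  forall (I : Type) (s : seq I) (F : I -> V),
    f (\sum_(i <- s) F i) = \sum_(i <- s) f (F i).
Proof. by move=> fD I s F; apply: big_morph; last exact: morphD_0. Qed.

(* [A] is a direct sum decomposition of R when every r has exactly one
   [is_decomposition A r d]. *)
Definition is_decomposition (I : choiceType) (R : zmodType) (A : I -> set R)
    (r : R) (d : {malg R[I]}) : Prop :=
  (forall i, A i d@_i) /\ r = \sum_(i <- msupp d) d@_i.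

Record grading (G : groupType) (R : pzRingType) := Grading {
  gcomp :> G -> set R;
  gcomp0 : forall g, gcomp g 0;
  gcompB : forall g x y, gcomp g x -> gcomp g y -> gcomp g (x - y);
  gcompM : forall g h x y, gcomp g x -> gcomp h y -> gcomp (g * h)%g (x * y);
  gcomp_direct : forall r, exists! d, is_decomposition gcomp r d }.

Definition homogeneous (G : groupType) (R : pzRingType) (A : grading G R)
  (r : R) : Prop := exists g, A g r.

Definition nilpotent (R : pzRingType) (r : R) : Prop := exists n, r ^+ n = 0.

(* [pzRingType] carries no [GRing.unit] predicate. *)
Definition invertible (R : pzRingType) (r : R) : Prop :=
  exists s, s * r = 1 /\ r * s = 1.

Definition graded_nil_good (G : groupType) (R : pzRingType) (A : grading G R) :
    Prop :=
  forall r, homogeneous A r ->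
    nilpotent r \/
    exists u n : R, [/\ homogeneous A u, invertible u,
                        homogeneous A n, nilpotent n & r = u + n].

Section GradingTheory.
Context (G : groupType) (R : pzRingType) (A : grading G R).

Definition gdec (r : R) : {malg R[G]} := sval (cid (gcomp_direct A r)).

Lemma gdecP r : is_decomposition A r (gdec r).
Proof. exact: (svalP (cid (gcomp_direct A r))).1. Qed.

Lemma gdec_uniq r d : is_decomposition A r d -> gdec r = d.
Proof. exact: (svalP (cid (gcomp_direct A r))).2. Qed.

Lemma gcompN g x : A g x -> A g (- x).
Proof. by move=> Ax; rewrite -sub0r; apply: gcompB Ax; apply: gcomp0. Qed.

Lemma gcompD g x y : A g x -> A g y -> A g (x + y).
Proof. by move=> Ax Ay; rewrite -[y]opprK; apply: gcompB => //; apply: gcompN. Qed.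

Lemma gcomp_sum g (I : eqType) (s : seq I) (F : I -> R) :
  (forall i, i \in s -> A g (F i)) -> A g (\sum_(i <- s) F i).
Proof.
move=> AF; rewrite big_seq; elim/big_rec: _ => [|i x si Ax]; first exact: gcomp0.
by apply: gcompD => //; apply: AF.
Qed.

Lemma gdec_hom g r : A g r -> gdec r = << r *g g >>.
Proof.
move=> Ar; apply: gdec_uniq; split=> [h|].
  by rewrite mcoeffU; case: eqP => [<-|_]; rewrite ?mulr1n ?mulr0n //; apply: gcomp0.
by rewrite -[RHS]/(msum (fun _ v => v) _) msumU.
Qed.

Lemma gdecD : {morph gdec : x y / x + y}.
Proof.
move=> x y; apply: gdec_uniq; split=> [g|].
  by rewrite mcoeffD; apply: gcompD; apply: (gdecP _).1.
rewrite -[RHS]/(msum (fun _ v => v) _) msumD //.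
by rewrite {1}(gdecP x).2 {1}(gdecP y).2.
Qed.

Lemma gdec_comp r g : A g (gdec r)@_g.
Proof. exact: (gdecP r).1. Qed.

Lemma hom_ind (P : R -> Prop) : P 0 -> (forall x y, P x -> P y -> P (x + y)) ->
  (forall g x, A g x -> P x) -> forall r, P r.
Proof.
move=> P0 PD PU r; rewrite (gdecP r).2; elim/big_rec: _ => // g x _ Px.
by apply: PD => //; apply: PU (gdec_comp r g).
Qed.

Lemma gcomp1 : A 1%g 1.
Proof.
suff e_id r : r * (gdec 1)@_1%g = r by rewrite -[X in A _ X]e_id mul1r; apply: gdec_comp.
elim/hom_ind: r => [|x y ex ey|h r Ar]; first by rewrite mul0r.
  by rewrite mulrDl ex ey.
have E : gdec r = msum (fun g v => << r * v *g (h * g)%g >>) (gdec 1).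
  rewrite -{1}[r]mulr1 [X in gdec (_ * X)](gdecP 1).2 mulr_sumr (morphD_sum gdecD).
  by apply: eq_bigr => g _; apply/gdec_hom/gcompM => //; apply: gdec_comp.
have := congr1 (mcoeff h) E; rewrite (gdec_hom Ar) mcoeffUU => {2}->.
rewrite /msum raddf_sum /=.
have E1 : (gdec 1)@_1%g = msum (fun g v => v *+ (h * g == h)%g) (gdec 1).
  rewrite (@msumEw _ _ _ _ _ _ (1%g |` msupp (gdec 1))%fset); last exact: fsubsetUr.
    rewrite (big_fsetD1 1%g) ?fset1U1 //= mulg1 eqxx mulr1n big1_fset ?addr0 // => g.
    by rewrite in_fsetD1 -{2}[h]mulg1 (can_eq (mulKg h)) => /andP[/negPf->].
  by move=> k; rewrite mul0rn.
rewrite {1}E1 /msum mulr_sumr; apply: eq_bigr => g _.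
by rewrite mcoeffU mulrnAr.
Qed.

End GradingTheory.

Lemma direct_of_projection (I : choiceType) (R : zmodType) (B : I -> set R)
    (d : R -> {malg R[I]}) :
  {morph d : x y / x + y} -> (forall i x, B i x -> d x = << x *g i >>) ->
  (forall x, is_decomposition B x (d x)) ->
  forall x, exists! d, is_decomposition B x d.
Proof.
move=> dD dB dP x; exists (d x); split=> // e [Be ->].
rewrite (morphD_sum dD) [RHS]monalgE; apply: eq_bigr => i _; exact: dB.
Qed.

Section QuoGrading.
Context (G : groupType) (R : pzRingType) (A : grading G R).
Context (H : normal_subgroup G).

(* The sum of the R_x with x in the coset C. *)
Definition quo_comp (C : quo H) : set R := fun r =>
  exists d : {malg R[G]}, is_decomposition A r d /\
    forall x, x \in msupp d -> \pi_(quo H) x = C.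

Definition quo_dec (r : R) : {malg R[quo H]} :=
  \sum_(x <- msupp (gdec A r)) << (gdec A r)@_x *g \pi_(quo H) x >>.

Lemma quo_compE C r :
  quo_comp C r <-> forall x, (gdec A r)@_x != 0 -> \pi_(quo H) x = C.
Proof.
split=> [[d [/gdec_uniq-> dC]] x|rC].
  by rewrite mcoeff_neq0; apply: dC.
exists (gdec A r); split=> [|x]; first exact: gdecP.
by rewrite -mcoeff_neq0; apply: rC.
Qed.

Lemma quo_comp_hom x r : A x r -> quo_comp (\pi_(quo H) x) r.
Proof.
move=> Ar; apply/quo_compE => y; rewrite (gdec_hom Ar) mcoeffU.
by have [->|_] := eqVneq x y; rewrite // mulr0n eqxx.
Qed.

Lemma quo_comp0 C : quo_comp C 0.
Proof.
by apply/quo_compE => x; rewrite (morphD_0 (gdecD A)) mcoeff0 eqxx.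
Qed.

Lemma quo_compD C r s : quo_comp C r -> quo_comp C s -> quo_comp C (r + s).
Proof.
move=> /quo_compE rC /quo_compE sC; apply/quo_compE => x.
rewrite gdecD mcoeffD; have [->|/rC//] := eqVneq (gdec A r)@_x 0.
by rewrite add0r => /sC.
Qed.

Lemma quo_compB C r s : quo_comp C r -> quo_comp C s -> quo_comp C (r - s).
Proof.
move=> rC /quo_compE sC; apply: quo_compD => //; apply/quo_compE => x.
have -> : gdec A (- s) = - gdec A s.
  by apply/eqP; rewrite -addr_eq0 -gdecD addNr (morphD_0 (gdecD A)).
by rewrite mcoeffN oppr_eq0; apply: sC.
Qed.

Lemma quo_comp_sum C (I : eqType) (s : seq I) (F : I -> R) :
  (forall i, i \in s -> quo_comp C (F i)) -> quo_comp C (\sum_(i <- s) F i).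
Proof.
move=> AF; rewrite big_seq; elim/big_rec: _ => [|i x si Ax]; first exact: quo_comp0.
by apply: quo_compD => //; apply: AF.
Qed.

Lemma quo_compM C D r s :
  quo_comp C r -> quo_comp D s -> quo_comp (C * D)%g (r * s).
Proof.
case=> d [[Ad ->] dC] [e [[Ae ->] eD]]; rewrite mulr_suml.
apply: quo_comp_sum => x /dC <-; rewrite mulr_sumr.
apply: quo_comp_sum => y /eD <-; rewrite -pi_quoM.
by apply/quo_comp_hom/gcompM.
Qed.

Lemma quo_decE r : quo_dec r = msum (fun x v => << v *g \pi_(quo H) x >>) (gdec A r).
Proof. by []. Qed.

Lemma quo_decD : {morph quo_dec : r s / r + s}.
Proof.
move=> r s; rewrite !quo_decE gdecD msumD // => [k|k u v]; first exact: monalgU0.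
exact: monalgUD.
Qed.

Lemma quo_dec_comp r C : quo_comp C (quo_dec r)@_C.
Proof.
rewrite /quo_dec raddf_sum /=; apply: quo_comp_sum => x _.
rewrite mcoeffU; case: eqP => [<-|_]; last exact: quo_comp0.
by apply/quo_comp_hom/gdec_comp.
Qed.

Lemma quo_dec_hom C r : quo_comp C r -> quo_dec r = << r *g C >>.
Proof.
move=> /quo_compE rC; rewrite /quo_dec [in RHS](gdecP A r).2 raddf_sum /=.
rewrite big_seq [RHS]big_seq; apply: eq_bigr => x.
by rewrite -mcoeff_neq0 => /rC ->.
Qed.

Lemma quo_dec_sum r : r = \sum_(C <- msupp (quo_dec r)) (quo_dec r)@_C.
Proof.
rewrite -[RHS]/(msum (fun _ v => v) _) /quo_dec morphD_sum; last exact: msumD.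
by rewrite {1}(gdecP A r).2; apply: eq_bigr => x _; rewrite msumU.
Qed.

Lemma quo_direct r : exists! d, is_decomposition quo_comp r d.
Proof.
apply: direct_of_projection quo_decD quo_dec_hom _ r => r.
by split; [exact: quo_dec_comp|exact: quo_dec_sum].
Qed.

Definition quo_grading : grading (quo H) R :=
  Grading quo_comp0 quo_compB quo_compM quo_direct.

End QuoGrading.

(* R[G]; A only serves to select the twisted multiplication below. *)
Definition gring (G : groupType) (R : pzRingType) (A : grading G R) : Type :=
  {malg R[G]}.

HB.instance Definition _ (G : groupType) (R : pzRingType) (A : grading G R) :=
  GRing.Zmodule.on (gring A).

Section GradedGroupRing.
Context (G : groupType) (R : pzRingType) (A : grading G R).
Local Notation S := (gring A).

(* The rule (r_g x) (s_h y) = r_g s_h (h^-1 x h y) does not involve g, so only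
   the coefficients of the right factor need to be decomposed. *)
Definition gring_mul (a b : S) : S :=
  \sum_(x <- msupp a) \sum_(y <- msupp b) \sum_(h <- msupp (gdec A b@_y))
     << a@_x * (gdec A b@_y)@_h *g (h^-1 * x * h * y)%g >>.

Definition gring_one : S := << 1 *g 1%g >>.

Definition gring_mul3 (x y : G) (r : R) (h : G) (t : R) : S :=
  << r * t *g (h^-1 * x * h * y)%g >>.
Definition gring_mul2 (x : G) (r : R) (y : G) (s : R) : S :=
  msum (gring_mul3 x y r) (gdec A s).
Definition gring_mul1 (b : S) (x : G) (r : R) : S := msum (gring_mul2 x r) b.

Lemma gring_mulE a b : gring_mul a b = msum (gring_mul1 b) a.
Proof. by []. Qed.

Lemma gring_mul3D x y r h : {morph gring_mul3 x y r h : s t / s + t}.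
Proof. by move=> s t; rewrite /gring_mul3 mulrDr monalgUD. Qed.

Lemma gring_mul2D x r y : {morph gring_mul2 x r y : s t / s + t}.
Proof.
move=> s t; rewrite /gring_mul2 gdecD msumD // => k; last exact: gring_mul3D.
exact: morphD_0 (gring_mul3D x y r k).
Qed.

Lemma gring_mul1D b x : {morph gring_mul1 b x : r s / r + s}.
Proof.
move=> r s; rewrite /gring_mul1 /msum -big_split; apply: eq_bigr => y _.
rewrite /gring_mul2 /msum -big_split; apply: eq_bigr => h _.
by rewrite /gring_mul3 mulrDl monalgUD.
Qed.

Lemma gring_mulDl : left_distributive gring_mul +%R.
Proof.
move=> a b c; rewrite !gring_mulE msumD // => k; last exact: gring_mul1D.
exact: (morphD_0 (gring_mul1D _ k)).
Qed.

Lemma gring_mulDr : right_distributive gring_mul +%R.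
Proof.
move=> a b c; rewrite !gring_mulE /msum -big_split; apply: eq_bigr => x _.
rewrite /gring_mul1 msumD // => k; last exact: gring_mul2D.
exact: (morphD_0 (gring_mul2D _ _ k)).
Qed.

Lemma gring_mulUU x y h (r s : R) : A h s ->
  gring_mul << r *g x >> << s *g y >> = << r * s *g (h^-1 * x * h * y)%g >>.
Proof.
move=> As; rewrite gring_mulE msumU => [|k]; last exact: (morphD_0 (gring_mul1D _ k)).
rewrite /gring_mul1 msumU => [|k]; last exact: (morphD_0 (gring_mul2D _ _ k)).
rewrite /gring_mul2 (gdec_hom As) msumU // => k.
exact: morphD_0 (gring_mul3D x y r k).
Qed.

Lemma gring_ind (P : S -> Prop) : P 0 -> (forall a b, P a -> P b -> P (a + b)) ->
  (forall g x r, A g r -> P << r *g x >>) -> forall a, P a.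
Proof.
move=> P0 PD PU a; rewrite [a]monalgE; elim/big_rec: _ => // x b _.
apply: (PD); move: a@_x => r.
elim/(hom_ind (A := A)): r => [|r s Pr Ps|g r Ar]; last exact: PU Ar.
  by rewrite monalgU0.
by rewrite monalgUD; exact: PD.
Qed.

Lemma gring_mul0r : left_zero 0 gring_mul.
Proof. by move=> b; exact: morphD_0 (fun x y => gring_mulDl x y b). Qed.

Lemma gring_mulr0 : right_zero 0 gring_mul.
Proof. by move=> b; exact: morphD_0 (gring_mulDr b). Qed.

Lemma gring_mul1r : left_id gring_one gring_mul.
Proof.
elim/gring_ind=> [|a b ea eb|g x r Ar]; first by rewrite gring_mulr0.
  by rewrite gring_mulDr ea eb.
by rewrite (gring_mulUU _ _ _ Ar) mulg1 mulVg mul1g mul1r.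
Qed.

Lemma gring_mulr1 : right_id gring_one gring_mul.
Proof.
elim/gring_ind=> [|a b ea eb|g x r Ar]; first by rewrite gring_mul0r.
  by rewrite gring_mulDl ea eb.
by rewrite (gring_mulUU _ _ _ (gcomp1 A)) invg1 mul1g !mulg1 mulr1.
Qed.

Lemma gring_mulA : associative gring_mul.
Proof.
elim/gring_ind=> [|a a' ea ea'|g x r Ar] b c; first by rewrite !gring_mul0r.
  by rewrite !gring_mulDl ea ea'.
elim/gring_ind: b => [|b b' eb eb'|h y s As].
- by rewrite gring_mul0r gring_mulr0 gring_mul0r.
- by rewrite !(gring_mulDl, gring_mulDr) eb eb'.
elim/gring_ind: c => [|c c' ec ec'|k z t At].
- by rewrite !gring_mulr0.
- by rewrite !gring_mulDr ec ec'.
rewrite (gring_mulUU _ _ _ As) !(gring_mulUU _ _ _ At).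
rewrite (gring_mulUU _ _ _ (gcompM As At)) mulrA invgM.
by congr << _ *g _ >>; rewrite !mulgA mulgK.
Qed.

HB.instance Definition _ := GRing.Zmodule_isPzRing.Build S
  gring_mulA gring_mul1r gring_mulr1 gring_mulDl gring_mulDr.

Lemma gringUM x y h (r s : R) : A h s ->
  (<< r *g x >> : S) * << s *g y >> = << r * s *g (h^-1 * x * h * y)%g >>.
Proof. exact: gring_mulUU. Qed.

End GradedGroupRing.

Section GradedSubgroupRing.
Context (G : groupType) (R : pzRingType) (A : grading G R).
Context (H : normal_subgroup G).

Definition supported : {pred gring A} :=
  fun a => `[< forall x, x \in msupp (a : {malg R[G]}) -> H x >].

Lemma supportedP (a : gring A) :
  reflect (forall x, mcoeff x a != 0 -> H x) (a \in supported).
Proof.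
by apply: (iffP (asboolP _)) => aH x; have := aH x; rewrite mcoeff_neq0.
Qed.

Lemma supported0 : 0 \in supported.
Proof. by apply/supportedP => x; rewrite mcoeff0 eqxx. Qed.

Lemma supportedN a : a \in supported -> - a \in supported.
Proof.
by move=> /supportedP aH; apply/supportedP=> x; rewrite mcoeffN oppr_eq0; apply: aH.
Qed.

Lemma supportedD a b :
  a \in supported -> b \in supported -> a + b \in supported.
Proof.
move=> /supportedP aH /supportedP bH; apply/supportedP=> x; rewrite mcoeffD.
by have [->|/aH//] := eqVneq (mcoeff x a) 0; rewrite add0r => /bH.
Qed.

Lemma supportedU x r : H x -> (<< r *g x >> : gring A) \in supported.
Proof.
move=> Hx; apply/supportedP=> y; rewrite mcoeffU.
by have [<-|_] := eqVneq x y; rewrite // mulr0n eqxx.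
Qed.

Lemma supported_sum (I : eqType) (s : seq I) (F : I -> gring A) :
  (forall i, i \in s -> F i \in supported) -> \sum_(i <- s) F i \in supported.
Proof.
move=> AF; rewrite big_seq; elim/big_rec: _ => [|i x si Ax]; first exact: supported0.
by apply: supportedD => //; apply: AF.
Qed.

Lemma supported_subring : GRing.subring_closed supported.
Proof.
split=> [|a b aH bH|a b /supportedP aH /supportedP bH].
- by apply: supportedU; exact: nsub1.
- by apply: supportedD => //; apply: supportedN.
apply: supported_sum => x; rewrite -mcoeff_neq0 => /aH Hx.
apply: supported_sum => y; rewrite -mcoeff_neq0 => /bH Hy.
apply: supported_sum => h _; apply: supportedU.
by apply: nsubM => //; apply: nsub_normal.
Qed.

(* R[H] *)
Record gsubring : Type := GSubring {
  gsub_val :> gring A;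
  gsub_valP : gsub_val \in supported }.

HB.instance Definition _ := [isSub for gsub_val].
HB.instance Definition _ := [Choice of gsubring by <:].
HB.instance Definition _ := GRing.SubChoice_isSubPzRing.Build
  (gring A) supported gsubring supported_subring.

(* The sum over h in H of the R_C h: since R[H] is free on H, an element lies in
   it iff all its coefficients are in R_C. *)
Definition gsub_comp (C : quo H) : set gsubring := fun a =>
  forall h, quo_comp A C (mcoeff h (val a)).

Lemma gsub_comp0 C : gsub_comp C 0.
Proof. by move=> h; rewrite mcoeff0; apply: quo_comp0. Qed.

Lemma gsub_compB C a b : gsub_comp C a -> gsub_comp C b -> gsub_comp C (a - b).
Proof. by move=> aC bC h; rewrite rmorphB mcoeffB; apply: quo_compB. Qed.

Lemma gsub_compM C D a b :
  gsub_comp C a -> gsub_comp D b -> gsub_comp (C * D)%g (a * b).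
Proof.
move=> aC bD h; rewrite rmorphM /= -[_ * _]/(gring_mul _ _) /gring_mul.
rewrite raddf_sum; apply: quo_comp_sum => x _.
rewrite raddf_sum; apply: quo_comp_sum => y _.
rewrite raddf_sum; apply: quo_comp_sum => z; rewrite -mcoeff_neq0 => bz.
rewrite /= mcoeffU; case: eqP => _; rewrite ?mulr0n ?mulr1n; last exact: quo_comp0.
apply: quo_compM; first exact: aC.
by rewrite -((quo_compE _ _ _).1 (bD y) z bz); apply/quo_comp_hom/gdec_comp.
Qed.

Lemma restr_key (a : gring A) :
  (\sum_(x <- msupp a | `[< H x >]) << mcoeff x a *g x >> : gring A) \in supported.
Proof.
rewrite -big_filter; apply: supported_sum => x.
by rewrite mem_filter => /andP[/asboolP Hx _]; apply: supportedU.
Qed.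

Definition gsub_restr (a : gring A) : gsubring := GSubring (restr_key a).

Lemma gsub_restr_coef (a : gring A) x :
  mcoeff x (gsub_restr a : gring A) = mcoeff x a *+ `[< H x >].
Proof.
rewrite /= raddf_sum /= big_mkcond /=.
pose f k (v : R) := if `[< H k >] then v *+ (k == x) else 0.
have -> : mcoeff x a *+ `[< H x >] = msum f a.
  rewrite [in LHS](monalgE a) raddf_sum /= -sumrMnl.
  apply: eq_bigr => k _; rewrite /f mcoeffU.
  by case: eqP => [->|_]; case: ifP; rewrite ?mulr0n ?mul0rn.
by apply: eq_bigr => k _; rewrite /f mcoeffU; case: ifP.
Qed.

Lemma gsub_eq (a b : gsubring) :
  (forall x, mcoeff x (val a) = mcoeff x (val b)) -> a = b.
Proof. by move=> ab; apply/val_inj/malgP. Qed.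

Lemma gsub_restrD : {morph gsub_restr : a b / a + b}.
Proof.
move=> a b; apply: gsub_eq => x.
by rewrite rmorphD !mcoeffD !gsub_restr_coef mcoeffD mulrnDl.
Qed.

Lemma gsub_restrK (a : gsubring) : gsub_restr (val a) = a.
Proof.
apply: gsub_eq => x; rewrite gsub_restr_coef; case: asboolP => // nHx.
have [->//|/(supportedP _ (valP a))//] := eqVneq (mcoeff x (val a)) 0.
Qed.

Definition gsub_dec2 (x : G) (C : quo H) (v : R) : {malg gsubring[quo H]} :=
  << gsub_restr << v *g x >> *g C >>.
Definition gsub_dec1 (x : G) (r : R) : {malg gsubring[quo H]} :=
  msum (gsub_dec2 x) (quo_dec A H r).
Definition gsub_dec (a : gsubring) : {malg gsubring[quo H]} :=
  msum gsub_dec1 (val a).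

Lemma gsub_dec2D x C : {morph gsub_dec2 x C : r s / r + s}.
Proof. by move=> r s; rewrite /gsub_dec2 monalgUD gsub_restrD monalgUD. Qed.

Lemma gsub_dec1D x : {morph gsub_dec1 x : r s / r + s}.
Proof.
move=> r s; rewrite /gsub_dec1 quo_decD msumD // => C; last exact: gsub_dec2D.
exact: (morphD_0 (gsub_dec2D x C)).
Qed.

Lemma gsub_decD : {morph gsub_dec : a b / a + b}.
Proof.
move=> a b; rewrite /gsub_dec rmorphD msumD // => x; last exact: gsub_dec1D.
exact: (morphD_0 (gsub_dec1D x)).
Qed.

Lemma gsub_comp_sum C (I : eqType) (s : seq I) (F : I -> gsubring) :
  (forall i, i \in s -> gsub_comp C (F i)) -> gsub_comp C (\sum_(i <- s) F i).
Proof.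
move=> AF h; rewrite rmorph_sum raddf_sum.
by apply: quo_comp_sum => i /AF; apply.
Qed.

Lemma gsub_dec_comp a C : gsub_comp C (gsub_dec a)@_C.
Proof.
rewrite /gsub_dec /msum raddf_sum; apply: gsub_comp_sum => x _.
rewrite /gsub_dec1 /msum raddf_sum; apply: gsub_comp_sum => D _ h.
rewrite /gsub_dec2 /= mcoeffU; case: eqP => [->|_]; last first.
  by rewrite mulr0n mcoeff0; exact: quo_comp0.
rewrite mulr1n gsub_restr_coef mcoeffU.
case: asboolP => _; rewrite ?mulr0n ?mulr1n; last exact: quo_comp0.
by case: eqP => _; rewrite ?mulr0n ?mulr1n; [exact: quo_dec_comp|exact: quo_comp0].
Qed.

Lemma gsub_dec_hom C a : gsub_comp C a -> gsub_dec a = << a *g C >>.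
Proof.
move=> aC; rewrite -[in RHS](gsub_restrK a) [in RHS](monalgE (val a)).
rewrite (morphD_sum gsub_restrD) raddf_sum; apply: eq_bigr => x _.
rewrite /gsub_dec1 (quo_dec_hom (aC x)) msumU //= => k.
exact: (morphD_0 (gsub_dec2D _ k)).
Qed.

Lemma gsub_dec_sum a : a = \sum_(C <- msupp (gsub_dec a)) (gsub_dec a)@_C.
Proof.
pose f (C : quo H) (v : gsubring) := v.
have fD : {morph msum f : a b / a + b} by apply: msumD.
rewrite -[RHS]/(msum f _) /gsub_dec {2}/msum (morphD_sum fD).
rewrite -{1}(gsub_restrK a) {1}(monalgE (val a)) (morphD_sum gsub_restrD).
apply: eq_bigr => x _; rewrite /gsub_dec1 {2}/msum (morphD_sum fD).
rewrite [in LHS](quo_dec_sum A H (mcoeff x (val a))) raddf_sum (morphD_sum gsub_restrD).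
by apply: eq_bigr => C _; rewrite msumU.
Qed.

Lemma gsub_direct a : exists! d, is_decomposition gsub_comp a d.
Proof.
apply: direct_of_projection gsub_decD gsub_dec_hom _ a => a.
by split; [exact: gsub_dec_comp|exact: gsub_dec_sum].
Qed.

Definition gsub_grading : grading (quo H) gsubring :=
  Grading gsub_comp0 gsub_compB gsub_compM gsub_direct.

End GradedSubgroupRing.

(* Main.v *)
From HB Require Import structures.
From mathcomp Require Import all_fingroup all_solvable.
From mathcomp Require Import finmap cardinality monalg.
Require Import Defs.
From mathcomp Require Import all_boot all_algebra.
From mathcomp Require Import boolp classical_sets.

(** The augmentation [aug] : R[G] -> R, which adds up the coefficients, is a ring
    morphism: the twist h^-1 x h by which R[G] differs from an ordinary group
    ring only moves group elements around. It is split by r |-> r 1, and both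
    maps respect the G/H-gradings of R[H] and R. The theorem follows once the
    kernel of [aug] is known to be nil ([aug0_nilpotent]): if a in R[H] is
    homogeneous and [aug a] is nilpotent, so is a; and if [aug a] = u + n with u
    a homogeneous unit and n nilpotent, then a = u 1 + (a - u 1), where u 1 is a
    unit and [aug (a - u 1)] = n is nilpotent. For a - u 1 to be homogeneous, u
    must have the degree of a, which can only fail when 1 = 0 in R
    ([graded_unit_nil_degree]).

    An element d of the kernel is a sum of terms r_h (x - 1) with r_h in R_h
    ([aug0_expand]). The finitely many x and h involved generate a finite
    p-group K. In R[G], p is nilpotent, and for every v there is an n such that
    v (x_1 - 1) ... (x_n - 1) = 0 for all x_i in K ([all_killed]); this is the
    nilpotency of the augmentation ideal of a finite p-group in characteristic
    p^k. Since r_h x = (h x h^-1) r_h, the coefficients r_h can be moved past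
    the factors x - 1, so right multiplication by d lowers the length n, and
    1 d^n = 0 ([lowers_nilpotent]).

    The bound n exists because of the fixed point property of p-groups: if the
    set V of the v that have one were not everything, some w outside V would be
    fixed by K modulo V ([fixed_vector]), that is, all w (x - 1) would lie in V,
    and then so would w. The fixed vector is found by going up a chain of
    subgroups, each normal of index p in the next. If the smaller one fixes w
    modulo V and x generates the larger one over it, then x^p fixes w, so that
    (x - 1)^p = x^p - 1 mod p sends w into V; the last w (x - 1)^i outside V is
    fixed by both. *)

Set Implicit Arguments.
Unset Strict Implicit.
Unset Printing Implicit Defensive.

Import GRing.Theory.
Local Open Scope ring_scope.

(** * Unipotent action of a finite p-group in characteristic p^k *)

(** The binomial formula, with the multiples of p set apart: p divides C(p, i) for
    0 < i < p. *)
Lemma exprD1_prime (S : pzRingType) (p : nat) (u : S) : prime p ->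
  exists c : nat -> nat,
    (u + 1) ^+ p = u ^+ p + 1 + (\sum_(i < p) u ^+ i *+ c i) *+ p.
Proof.
move=> p_pr; exists (fun i => if (0 < i)%N then 'C(p, i) %/ p else 0)%N.
rewrite exprD1n big_ord_recr /= binn mulr1n addrC -addrA; congr (_ + _).
case: p p_pr => // q q_pr; rewrite 2!big_ord_recl /= bin0 mulr1n expr0; congr (_ + _).
rewrite mulr0n add0r -sumrMnl; apply: eq_bigr => i _.
rewrite -mulrnA divnK //; apply: prime_dvd_bin => //.
by rewrite /= /bump /= add1n ltnS ltn_ord.
Qed.

Section Unipotent.
Context (S : pzRingType) (p : nat) (gT : finGroupType) (phi : gT -> S).
Hypothesis p_pr : prime p.
Hypothesis gT_p : p.-group%g [set: gT].
Hypothesis phi1 : phi 1%g = 1.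
Hypothesis phiM : forall x y, phi (x * y)%g = phi x * phi y.

(** Vectors fixed by the group in S / V, expressed in S so that V can remain a
    predicate and no quotient is formed. *)
Section FixedVector.
Context (V : S -> Prop).
Hypothesis V0 : V 0.
Hypothesis VB : forall v w, V v -> V w -> V (v - w).
Hypothesis Vphi : forall g v, V v -> V (v * phi g).

Let VD v w : V v -> V w -> V (v + w).
Proof.
by move=> Vv Vw; rewrite -[w]opprK; apply: VB => //; rewrite -sub0r; apply: VB.
Qed.

Let VMn v n : V v -> V (v *+ n).
Proof. by move=> Vv; elim: n => [|n IH]; rewrite ?mulr0n // mulrS; apply: VD. Qed.

Definition fixes_mod w g := V (w * phi g - w).

Let fixesM w g h : fixes_mod w g -> fixes_mod w h -> fixes_mod w (g * h)%g.
Proof.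
move=> Vg Vh; rewrite /fixes_mod phiM mulrA.
have -> : w * phi g * phi h - w = (w * phi g - w) * phi h + (w * phi h - w).
  by rewrite mulrBl addrA subrK.
by apply: VD => //; apply: Vphi.
Qed.


Let V_mul_subr1 x v : V v -> V (v * (phi x - 1)).
Proof. by move=> Vv; rewrite mulrBr mulr1; apply: VB => //; apply: Vphi. Qed.

Let V_mulX x v i : V v -> V (v * (phi x - 1) ^+ i).
Proof.
move=> Vv; elim: i => [|i IH]; first by rewrite mulr1.
by rewrite exprSr mulrA; apply: V_mul_subr1.
Qed.

(** Modulo p, (x - 1)^p = x^p - 1. *)
Let V_expp x v : fixes_mod v (x ^+ p)%g -> V (v *+ p) -> V (v * (phi x - 1) ^+ p).
Proof.
move=> Vxp Vpv; have [c] := exprD1_prime (phi x - 1) p_pr.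
rewrite subrK => phixp.
have -> : v * (phi x - 1) ^+ p =
    (v * phi (x ^+ p)%g - v) - \sum_(i < p) (v *+ p) * (phi x - 1) ^+ i *+ c i.
  have -> : phi (x ^+ p)%g = phi x ^+ p.
    by elim: (p) => [|n IHn]; rewrite ?expg0 // expgS phiM IHn exprS.
  rewrite phixp !mulrDr mulr1 mulrnAr -mulrnAl mulr_sumr.
  under [X in _ + X - v]eq_bigr do rewrite mulrnAr.
  by rewrite addrAC addrK addrK.
apply: VB => //; elim/big_rec: _ => // i y _ Vy.
by apply: VD => //; apply/VMn/V_mulX.
Qed.

(** If x normalises a subgroup, then x, and so x - 1, preserves the vectors that
    the subgroup fixes modulo V; this is that statement one element at a time. *)
Let fixes_mod_conj w x g : fixes_mod w g -> fixes_mod w (g ^ x^-1)%g ->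
  fixes_mod (w * (phi x - 1)) g.
Proof.
move=> Vg Vgx; rewrite /fixes_mod.
have -> : w * (phi x - 1) * phi g - w * (phi x - 1) =
    (w * phi (g ^ x^-1)%g - w) * phi x - (w * phi g - w).
  rewrite !(mulrBr, mulrBl) !mulr1 -!mulrA -!phiM conjgE invgK -!mulgA mulVg mulg1.
  by rewrite !opprD !opprK addrACA.
by apply: VB => //; apply: Vphi.
Qed.

(** Induction on K through a maximal subgroup M, which is normal of index p. The
    condition on [w *+ p] is what makes (x - 1)^p act as x^p - 1, and it survives
    the passage from w to w (x - 1)^i. *)
Lemma fixed_vector_subgroup (K : {group gT}) w : ~ V w -> V (w *+ p) ->
  exists w', [/\ ~ V w', V (w' *+ p) & forall g, g \in K -> fixes_mod w' g].
Proof.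
move=> nVw Vpw; have [n] := ubnP #|K|; elim: n => // n IH in K *; rewrite ltnS => leKn.
have [eK|[M maxM _]] := maximal_exists (sub1G K).
  exists w; split=> // g; rewrite -eK /= => /set1P->.
  by rewrite /fixes_mod phi1 mulr1 subrr.
have pK : p.-group%g K by apply: pgroupS gT_p; apply: finset.subsetT.
have [nsMK indexM] := (p_maximal_normal pK maxM, p_maximal_index pK maxM).
have [sMK nMK] := andP nsMK; have prMK := maxgroupp maxM.
have [v [nVv Vpv fv]] := IH M (leq_trans (proper_card prMK) leKn).
have [_ [x Kx nMx]] := fintype.properP prMK.
have Nx := fintype.subsetP nMK x Kx.
(* K / M has order p. *)
have Mxp : (x ^+ p)%g \in M.
  apply: coset_idr; first exact: groupX.
  rewrite morphX // -indexM -card_quotient //.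
  by apply/eqP; rewrite -order_dvdn order_dvdG // mem_quotient.
pose vi i := v * (phi x - 1) ^+ i.
have fvi i g : g \in M -> fixes_mod (vi i) g.
  elim: i g => [|i IHi] g Mg; first by rewrite /vi mulr1; apply: fv.
  rewrite /vi exprSr mulrA; apply: fixes_mod_conj; first exact: IHi.
  by apply: IHi; rewrite memJ_norm // groupV.
(* The last of the v (x - 1)^i outside V; there is one since v (x - 1)^p is in V. *)
have [i nVi Vi] : exists2 i, ~ V (vi i) & V (vi i.+1).
  have: V (vi p) by apply: V_expp => //; apply: fv.
  elim: (p) => [|m IHm]; first by rewrite /vi mulr1.
  by case: (EM (V (vi m))) => [/IHm ex_m _|nVm Vm]; [exact: ex_m|exists m].
exists (vi i); split=> //; first by rewrite -mulrnAl; apply: V_mulX.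
have xfix : fixes_mod (vi i) x.
  by move: Vi; rewrite /vi exprSr mulrA mulrBr mulr1.
(* The stabiliser of [vi i] modulo V contains M and x, hence K by maximality. *)
pose F := [set g | `[< fixes_mod (vi i) g >]]%SET.
have F_group : group_set F.
  apply/group_setP; split=> [|g h]; rewrite !finset.in_set.
    by apply/asboolP; rewrite /fixes_mod phi1 mulr1 subrr.
  by move=> /asboolP gF /asboolP hF; apply/asboolP/fixesM.
pose FK := (group F_group :&: K)%G.
have sMF : M \subset FK.
  apply/fintype.subsetP => g Mg.
  by rewrite !finset.inE (fintype.subsetP sMK g Mg) andbT; apply/asboolP/fvi.
have := maximal_eqP M K; rewrite /maximal_eq maxM orbT => /elimT/(_ isT)[_ maxMP].
have [eM|eK] := maxMP FK sMF (finset.subsetIr _ _).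
  case/negP: nMx; rewrite -eM !finset.inE Kx andbT; exact/asboolP.
by move=> g; rewrite -eK !finset.inE => /andP[/asboolP].
Qed.

(** Multiplying w by the last power of p that keeps it outside V reduces to the
    case where p w lies in V. *)
Lemma fixed_vector w : ~ V w -> (exists k, w *+ (p ^ k) = 0) ->
  exists2 w', ~ V w' & forall g, V (w' * phi g - w').
Proof.
move=> nVw [k wk].
have [i nVi Vi] : exists2 i, ~ V (w *+ p ^ i) & V (w *+ p ^ i.+1).
  have: V (w *+ p ^ k) by rewrite wk.
  elim: (k) => [|m IHm]; first by rewrite expn0 mulr1n.
  by case: (EM (V (w *+ p ^ m))) => [/IHm ex_m _|nVm Vm]; [exact: ex_m|exists m].
rewrite expnSr mulrnA in Vi.
have [w' [nVw' _ fw']] := fixed_vector_subgroup [group of [set: gT]] nVi Vi.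
by exists w' => // g; apply: fw'; rewrite inE.
Qed.

End FixedVector.

(** [killed n v]: every product v (x_1 - 1) ... (x_n - 1) vanishes. *)
Fixpoint killed n v : Prop :=
  if n is m.+1 then forall g, killed m (v * (phi g - 1)) else v = 0.

Lemma killed0 n : killed n 0.
Proof. by elim: n => //= n IH g; rewrite mul0r. Qed.

Lemma killedB n v w : killed n v -> killed n w -> killed n (v - w).
Proof.
elim: n v w => [v w -> ->|n IH v w kv kw g] /=; first by rewrite subrr.
by rewrite mulrBl; apply: IH.
Qed.

Lemma killedD n v w : killed n v -> killed n w -> killed n (v + w).
Proof.
by move=> kv kw; rewrite -[w]opprK; apply: killedB => //; rewrite -sub0r;
  apply: killedB => //; apply: killed0.
Qed.

Lemma killedS n v : killed n v -> killed n.+1 v.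
Proof. by elim: n v => /= [v -> g|n IH v kv g]; [rewrite mul0r|apply/IH]. Qed.

Lemma killed_leq m n v : (m <= n)%N -> killed m v -> killed n v.
Proof. by move/subnK<- => km; elim: (n - m)%N => // k; apply: killedS. Qed.

Definition normalises b := forall g, exists g', b * phi g = phi g' * b.

Lemma normalises_phi g : normalises (phi g).
Proof.
by move=> h; exists (h ^ g^-1)%g; rewrite -!phiM conjgE invgK !mulgA mulgKV.
Qed.

(** If b x = x' b, then v b (x - 1) = v (x' - 1) b. *)
Lemma killedM n v b : normalises b -> killed n v -> killed n (v * b).
Proof.
move=> nb; elim: n v => [v ->|n IH v kv g] /=; first by rewrite mul0r.
have [g' bg] := nb g.
have -> : v * b * (phi g - 1) = v * (phi g' - 1) * b.
  by rewrite -!mulrA mulrBr mulrBl mulr1 mul1r bg.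
exact: IH.
Qed.

Hypothesis p_nil : exists k, (p ^ k)%:R = 0 :> S.

(** The v killed at some length form a submodule. If it were proper, a vector w
    fixed modulo it would have each w (x - 1) killed at some length; as the group
    is finite, one length serves for all x, so w itself would be killed. *)
Lemma all_killed v : exists n, killed n v.
Proof.
have [//|nk] := EM (exists n, killed n v).
have [k pk0] := p_nil.
have [||||w nkw wk] := @fixed_vector (fun v => exists n, killed n v) _ _ _ v nk.
- by exists 0%N.
- move=> x y [m km] [n kn]; exists (maxn m n); apply: killedB.
    exact: killed_leq (leq_maxl _ _) km.
  exact: killed_leq (leq_maxr _ _) kn.
- by move=> g x [n kn]; exists n; apply: killedM => //; apply: normalises_phi.
- by exists k; rewrite -mulr_natr pk0 mulr0.
- case: nkw; have /choice[f fP] := wk.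
  exists (\max_g f g).+1 => g; rewrite mulrBr mulr1.
  exact: killed_leq (leq_bigmax g) (fP g).
Qed.

(** The property that the terms b (x - 1), with b normalising the group, share with
    their sums, and that bounds the powers of such a sum. *)
Definition lowers d := forall n v, killed n.+1 v -> killed n (v * d).

Lemma lowers0 : lowers 0.
Proof. by move=> n v _; rewrite mulr0; apply: killed0. Qed.

Lemma lowersD d e : lowers d -> lowers e -> lowers (d + e).
Proof.
by move=> ld le n v kv; rewrite mulrDr; apply: killedD; [apply: ld|apply: le].
Qed.

Lemma lowers_normalises b g : normalises b -> lowers (b * (phi g - 1)).
Proof. by move=> nb n v kv; rewrite mulrA; have /(_ g) := killedM nb kv. Qed.

Lemma lowers_nilpotent d : lowers d -> nilpotent d.
Proof.
move=> ld; have [n k1] := all_killed 1; exists n.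
suff: forall v, killed n v -> v * d ^+ n = 0 by move/(_ 1 k1); rewrite mul1r.
elim: n {k1} => [|n IH] v kv; first by rewrite mulr1.
by rewrite exprS mulrA; apply/IH/ld.
Qed.

End Unipotent.

(** * Finite subgroups of a locally finite p-group *)

(** Presents a finite subgroup of an abstract group as a [finGroupType], so that
    the theory of finite p-groups applies to it. *)
Lemma finite_subgroup (G : groupType) (K : set G) :
  is_subgroup K -> finite_set K ->
  exists (gT : finGroupType) (f : gT -> G),
    [/\ injective f, {morph f : x y / (x * y)%g}
      & forall x, K x <-> exists g, f g = x].
Proof.
move=> [K1 KV] /finite_fsetP[X eK].
have inX x : (x \in X) <-> K x by rewrite eK.
have XV x : x \in X -> (x^-1)%g \in X.
  by rewrite !inX => Kx; rewrite -[(x^-1)%g]mul1g; apply: KV.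
have XM x y : x \in X -> y \in X -> (x * y)%g \in X.
  by rewrite !inX => Kx Ky; rewrite -[y]invgK; apply: KV => //; apply/inX/XV/inX.
have X1 : 1%g \in X by apply/inX.
pose mulX (x y : X) : X := [` XM _ _ (valP x) (valP y)]%fset.
pose oneX : X := [` X1]%fset.
pose invX (x : X) : X := [` XV _ (valP x)]%fset.
have mulXA : associative mulX by move=> x y z; apply/val_inj; rewrite /= mulgA.
have mul1X : left_id oneX mulX by move=> x; apply/val_inj; rewrite /= mul1g.
have mulVX : left_inverse oneX invX mulX by move=> x; apply/val_inj; rewrite /= mulVg.
pose mix := Finite_isGroup.Build (fset_sub_type X) mulXA mul1X mulVX.
pose gT : finGroupType := HB.pack (fset_sub_type X) mix.
exists gT, (fun x : X => val x); split=> //; first exact: val_inj.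
move=> x; split=> [/inX Xx|[g <-]]; first by exists [` Xx]%fset.
exact/inX/valP.
Qed.

(** By Cauchy's theorem, a prime dividing the order is the order of an element. *)
Lemma p_group_card (p : nat) (G : groupType) (gT : finGroupType) (f : gT -> G) :
  prime p -> p_group p G -> injective f -> {morph f : x y / (x * y)%g} ->
  p.-group%g [set: gT]%SET.
Proof.
move=> p_pr pG f_inj fM; apply/pgroupP=> q q_pr /(Cauchy q_pr)[x _ oxq].
have f1 : f 1%g = 1%g by apply: (mulgI (f 1%g)); rewrite -fM !mulg1.
have fX n : f (x ^+ n)%g = (f x ^+ n)%g.
  by elim: n => [|n IH]; rewrite ?expg0 ?f1 // !expgS fM IH.
have [n fxn] := pG (f x).
have : (#[x]%g %| p ^ n)%N.
  by rewrite order_dvdn; apply/eqP/f_inj; rewrite fX fxn f1.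
by rewrite oxq Euclid_dvdX // dvdn_prime2 // => /andP[].
Qed.

(** * The augmentation of the graded group ring *)

Section Augmentation.
Context (G : groupType) (R : pzRingType) (A : grading G R).
Local Notation S := (gring A).

Definition aug (a : S) : R := msum (fun _ r => r) a.

Lemma augD : {morph aug : a b / a + b}.
Proof. by move=> a b; rewrite /aug msumD. Qed.

Lemma augU r x : aug << r *g x >> = r.
Proof. by rewrite /aug msumU. Qed.

Lemma aug0 : aug 0 = 0.
Proof. exact: morphD_0 augD. Qed.

Lemma augB : {morph aug : a b / a - b}.
Proof. by move=> a b; apply: (addIr (aug b)); rewrite -augD !subrK. Qed.

(** On homogeneous terms, (r x)(s y) = r s (h^-1 x h y) has coefficient sum r s. *)
Lemma augM : {morph aug : a b / a * b}.
Proof.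
move=> a b; elim/gring_ind: b => [|b b' eb eb'|h y s As].
- by rewrite mulr0 aug0 mulr0.
- by rewrite mulrDr !augD eb eb' mulrDr.
elim/gring_ind: a => [|a a' ea ea'|g x r Ar].
- by rewrite mul0r aug0 mul0r.
- by rewrite mulrDl !augD ea ea' mulrDl.
by rewrite (gringUM _ _ _ As) !augU.
Qed.

Lemma augX a n : aug (a ^+ n) = aug a ^+ n.
Proof. by elim: n => [|n IH]; [apply: augU|rewrite !exprS augM IH]. Qed.

Definition scalar (r : R) : S := << r *g 1%g >>.

Lemma scalarD : {morph scalar : r s / r + s}.
Proof. exact: monalgUD. Qed.

(** The twist disappears at x = 1, so that R embeds as a subring. *)
Lemma scalarM : {morph scalar : r s / r * s}.
Proof.
move=> r s; elim/(Defs.hom_ind (A := A)): s => [|s t es et|h s As].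
- by rewrite mulr0 /scalar monalgU0 mulr0.
- by rewrite mulrDr !scalarD es et mulrDr.
by rewrite /scalar (gringUM _ _ _ As) !mulg1 mulVg.
Qed.

Definition point (x : G) : S := << 1 *g x >>.

Lemma scalar_point r x : scalar r * point x = << r *g x >>.
Proof. by rewrite (gringUM _ _ _ (gcomp1 A)) mulr1 invg1 !mul1g. Qed.

Lemma pointM : {morph point : x y / (x * y)%g >-> x * y}.
Proof. by move=> x y; rewrite (gringUM _ _ _ (gcomp1 A)) mulr1 invg1 mul1g mulg1. Qed.

Lemma point_scalar x h r : A h r ->
  point x * scalar r = scalar r * point (h^-1 * x * h)%g.
Proof. by move=> Ar; rewrite scalar_point (gringUM _ _ _ Ar) mul1r mulg1. Qed.

(** From a = sum of the a_x x, subtract (sum of the a_x) 1 = 0, and split each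
    a_x into its homogeneous components. *)
Lemma aug0_expand (a : S) : aug a = 0 ->
  a = \sum_(x <- msupp (a : {malg R[G]})) \sum_(h <- msupp (gdec A (mcoeff x a)))
        scalar (mcoeff h (gdec A (mcoeff x a))) * (point x - 1).
Proof.
move=> a0.
have inner x : \sum_(h <- msupp (gdec A (mcoeff x a)))
        scalar (mcoeff h (gdec A (mcoeff x a))) * (point x - 1) =
      << mcoeff x a *g x >> - scalar (mcoeff x a).
  rewrite -mulr_suml -(morphD_sum scalarD) -(gdecP A _).2.
  by rewrite mulrBr mulr1 scalar_point.
under eq_bigr do rewrite inner.
rewrite sumrB -(morphD_sum scalarD) -[X in scalar X]/(aug a) a0.
by rewrite /scalar monalgU0 subr0 -monalgE.
Qed.

Lemma gring_natr n : n%:R = scalar n%:R :> S.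
Proof. by rewrite /scalar monalgUMn. Qed.

(** The kernel of the augmentation is nil. The degrees of the components of the
    coefficients must be put into K together with the support: conjugation by a
    degree h occurs when r_h is moved past a group element, and it has to
    preserve K. *)
Lemma aug0_nilpotent (p : nat) (a : S) : prime p -> locally_finite G ->
  p_group p G -> nilpotent (p%:R : R) -> aug a = 0 -> nilpotent a.
Proof.
move=> p_pr lfG pG [k pk0] a0.
pose X := msupp (a : {malg R[G]}).
pose s := X ++ flatten [seq (msupp (gdec A (mcoeff x a)) : seq G) | x <- X].
pose K := smallest (@is_subgroup G) [set x | x \in s]%classic.
have K_sub : is_subgroup K.
  split=> [L [[L1 _] _] //|x y Kx Ky L sL].
  by case: (sL) => [[_ LV] _]; apply: LV; [apply: Kx|apply: Ky].
have [gT [f [f_inj fM fK]]] := finite_subgroup K_sub (lfG s).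
have f_onto x : x \in s -> exists g, f g = x.
  by move=> sx; apply/fK => L [_ sL]; apply: sL.
have f1 : f 1%g = 1%g by apply: (mulgI (f 1%g)); rewrite -fM !mulg1.
have fV g : f g^-1%g = ((f g)^-1)%g.
  by apply: (mulgI (f g)); rewrite -fM !mulgV.
pose phi g := point (f g).
apply: (@lowers_nilpotent _ p gT phi p_pr (p_group_card p_pr pG f_inj fM)).
- by rewrite /phi f1.
- by move=> g h; rewrite /phi fM pointM.
- by exists k; rewrite gring_natr natrX pk0 /scalar monalgU0.
rewrite (aug0_expand a0).
have lowers_sum (s' : seq G) (F : G -> S) :
    (forall x, x \in s' -> lowers phi (F x)) -> lowers phi (\sum_(x <- s') F x).
  move=> lF; rewrite big_seq; elim/big_rec: _ => [|x d sx ld]; first exact: lowers0.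
  by apply: lowersD => //; apply: lF.
apply: (lowers_sum) => x Xx; apply: (lowers_sum) => h Xh.
have [y <-] : exists g, f g = x by apply: f_onto; rewrite mem_cat Xx.
apply: lowers_normalises => g.
have [z fz] : exists g, f g = h.
  by apply: f_onto; rewrite mem_cat; apply/orP; right; apply/flatten_mapP; exists x.
exists (z * g * z^-1)%g; rewrite (point_scalar _ (gdec_comp _ _ _)).
by rewrite !fM fV fz !mulgA mulVg mul1g mulgKV.
Qed.

End Augmentation.

(** * The subring R[H] and the conclusion *)

Section AugmentationSubring.
Context (p : nat) (G : groupType) (R : pzRingType).
Context (A : grading G R) (H : normal_subgroup G).
Local Notation augH a := (aug (val (a : gsubring A H))).

Definition gscalar (r : R) : gsubring A H :=
  GSubring (supportedU A r (nsub1 H)).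

Lemma gscalarM : {morph gscalar : r s / r * s}.
Proof. by move=> r s; apply/val_inj; rewrite rmorphM; apply: scalarM. Qed.

Lemma gscalar1 : gscalar 1 = 1.
Proof. exact/val_inj. Qed.

Lemma gscalar_comp C r : quo_comp A C r -> gsub_comp C (gscalar r).
Proof.
move=> Cr h; rewrite /= mcoeffU; case: eqP => _; rewrite ?mulr1n // mulr0n.
exact: quo_comp0.
Qed.

Lemma gscalar_invertible r : invertible r -> invertible (gscalar r).
Proof. by case=> s [sr rs]; exists (gscalar s); rewrite -!gscalarM sr rs gscalar1. Qed.

Lemma aug_comp C a : gsub_comp C a -> quo_comp A C (augH a).
Proof. by move=> aC; apply: quo_comp_sum => x _; apply: aC. Qed.

Lemma aug_nilpotent (a : gsubring A H) : prime p -> locally_finite G -> p_group p G ->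
  nilpotent (p%:R : R) -> nilpotent (augH a) -> nilpotent a.
Proof.
move=> p_pr lfG pG pn [n an].
have [m am] : nilpotent (val a ^+ n).
  by apply: (aug0_nilpotent p_pr lfG pG pn); rewrite augX.
by exists (n * m)%N; apply/val_inj; rewrite rmorphXn exprM am rmorph0.
Qed.
End AugmentationSubring.

(** If u has degree D <> C, then the component of degree D of u + n is 0. This
    component is u, or u + n when n also has degree D; so the unit u is 0 or is
    the nilpotent element - n. *)
Lemma graded_unit_nil_degree (G : groupType) (R : pzRingType) (A : grading G R) C u n :
  homogeneous A u -> invertible u -> homogeneous A n -> nilpotent n ->
  A C (u + n) -> A C u \/ 1 = 0 :> R.
Proof.
move=> [D Du] [u' [u'u uu']] [E En] [k nk] Cun.
have [<-|neDC] := eqVneq D C; [by left|right].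
have : mcoeff D (gdec A (u + n)) = 0.
  by rewrite (gdec_hom Cun) mcoeffU eq_sym (negPf neDC).
rewrite gdecD mcoeffD (gdec_hom Du) (gdec_hom En) mcoeffUU mcoeffU.
case: eqP => _; last by rewrite mulr0n addr0 => u0; rewrite -u'u u0 mulr0.
rewrite mulr1n => /eqP; rewrite addr_eq0 => /eqP un.
have: u' ^+ k * u ^+ k = 1.
  elim: (k) => [|i IH]; first by rewrite mulr1.
  by rewrite exprSr exprS mulrA -(mulrA _ u') u'u mulr1.
by rewrite un exprNn nk !mulr0 => <-.
Qed.

Theorem theorem4p3 (p : nat) (G : groupType) (R : pzRingType)
    (A : grading G R) (H : normal_subgroup G) :
  prime p -> locally_finite G -> p_group p G ->
  nilpotent (p%:R : R) ->
  graded_nil_good (quo_grading A H) ->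
  graded_nil_good (gsub_grading A H).
Proof.
move=> p_pr lfG pG pn ngR a [C aC].
have nil b := @aug_nilpotent p G R A H b p_pr lfG pG pn.
have [|/nil|[u [n [hu iu hn nn aE]]]] := ngR (aug (val a)); try by left.
  by exists C; apply: aug_comp.
have [|uC|R0] := @graded_unit_nil_degree _ _ (quo_grading A H) C u n hu iu hn nn.
- by rewrite -aE; apply: aug_comp.
- right; exists (gscalar A H u), (a - gscalar A H u); split.
  + by exists C; apply: gscalar_comp.
  + exact: gscalar_invertible.
  + by exists C; apply: gsub_compB => //; apply: gscalar_comp.
  + by apply: nil; rewrite rmorphB augB aE augU addrAC subrr add0r.
  + by rewrite addrC subrK.
left; exists 1%N; apply: gsub_eq => x.
by rewrite -[LHS]mulr1 -[RHS]mulr1 R0 !mulr0.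
Qed.
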